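(* Let $G$ be a generalised dihedral group of order $2n$ over the abelian group $A$, and let $\Gamma=\mathrm{Cay}(G,S)$. If $|S\cap xA|\le 1$ or $|S\cap xA|\ge n-1$, then $\Gamma$ is isomorphic to a Cayley graph on the abelian group $A\times C_2$, and therefore $\gamma_{\mathrm{all}}^\infty(\Gamma)=\gamma(\Gamma)$.
   Context: Groups and graphs are finite. For an abelian group $A$, the generalised dihedral group over $A$ is $G=\langle A,x : x^2=1,\ x^{-1}ax=a^{-1}\ \forall a\in A\rangle$, i.e. the semidirect product $A\rtimes\langle x\rangle$ with $x\notin A$ of order 2 acting by inversion; $xA$ is the nontrivial coset of $A$. For a group $G$ and an inverse-closed subset $S\subseteq G$, $\mathrm{Cay}(G,S)$ is the graph with vertex set $G$ and an edge from $u$ to $us$ for every $u\in G$, $s\in S$. The identity may be allowed in $S$ (giving a loop at every vertex); such loops are irrelevant to domination. $C_2$ is the cyclic group of order 2. A vertex $u$ dominates a vertex $w$ if $w=u$ or $w$ is adjacent to $u$. A dominating set is a set $D$ of vertices such that every vertex is dominated by at least one vertex of $D$; $\gamma(\Gamma)$ is the smallest size of a dominating set of $\Gamma$. Guards located at the vertices of a set $D$ (one guard per vertex) can reconfigure to a set $D'$ if there is a bijection $f:D\to D'$ such that for every $d\in D$, either $f(d)=d$ or $f(d)$ is adjacent to $d$. An eternal dominating configuration for $\Gamma$ is a nonempty collection $\mathcal D$ of subsets of $V(\Gamma)$, all of the same cardinality, such that for every $D_i\in\mathcal D$ and every vertex $w\notin D_i$ there is $D_j\in\mathcal D$ with $w\in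 D_j$ such that guards at $D_i$ can reconfigure to $D_j$. An eternal dominating set is a member of some eternal dominating configuration. The eternal domination number $\gamma_{\mathrm{all}}^\infty(\Gamma)$ is the smallest cardinality of an eternal dominating set. *)

(* Defs.v *)
From HB Require Import structures.
From mathcomp Require Import all_boot all_fingroup zmodp.

Set Implicit Arguments.
Unset Strict Implicit.
Unset Printing Implicit Defensive.

Import GroupScope.

(* A graph is an adjacency relation on a finite type.  Loops are allowed, and
   the definitions below are meant for symmetric relations. *)
Section Graphs.

Variables (T : finType) (e : rel T).

Definition dominates (u w : T) : bool := (w == u) || e u w.

Definition dominating_set (D : {set T}) : bool :=
  [forall w, exists u in D, dominates u w].

(* The bijection D -> D' is the restriction to D of a function f on all of T;
   only the values of f on D matter. *)
Definition reconfigures (D D' : {set T}) : bool :=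
  [exists f : {ffun T -> T},
    [&& dinjectiveb f (mem D), f @: D == D'
      & [forall d in D, (f d == d) || e d (f d)]]].

Definition eternal_dominating_configuration (C : {set {set T}}) : bool :=
  [&& C != set0,
      [forall Di in C, forall Dj in C, #|Di| == #|Dj|]
    & [forall Di in C, forall w, (w \notin Di) ==>
        [exists Dj in C, (w \in Dj) && reconfigures Di Dj]]].

Definition eternal_dominating_set (D : {set T}) : bool :=
  [exists C : {set {set T}}, eternal_dominating_configuration C && (D \in C)].

Lemma dominating_setT : dominating_set [set: T].
Proof.
by apply/forallP => w; apply/existsP; exists w; rewrite inE /dominates eqxx.
Qed.

Lemma eternal_dominating_setT : eternal_dominating_set [set: T].
Proof.
apply/existsP; exists [set [set: T]]; rewrite set11 andbT.
apply/and3P; split.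
- by apply/set0Pn; exists [set: T]; rewrite set11.
- by apply/forall_inP => D /set1P->; apply/forall_inP => D' /set1P->.
- by apply/forall_inP => D /set1P->; apply/forallP => w; rewrite inE.
Qed.

(* The minima range over nonempty families, since [set: T] belongs to both
   (dominating_setT, eternal_dominating_setT). *)
Definition domination_number : nat :=
  #|[arg min_(D < [set: T] | dominating_set D) #|D| ]|.

Definition eternal_domination_number : nat :=
  #|[arg min_(D < [set: T] | eternal_dominating_set D) #|D| ]|.

End Graphs.

Definition graph_isomorphic (T1 T2 : finType) (e1 : rel T1) (e2 : rel T2)
  : Prop :=
  exists2 f : T1 -> T2, bijective f & forall u v, e2 (f u) (f v) = e1 u v.

Definition inverse_closed (gT : finGroupType) (S : {set gT}) : Prop :=
  forall s, s \in S -> s^-1 \in S.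

Definition cayley (gT : finGroupType) (S : {set gT}) : rel gT :=
  fun u v => [exists s in S, v == u * s].

(* The whole group gT is generalised dihedral over A, with inverting
   involution x; a ^ x is the conjugate x^-1 * a * x. *)
Definition generalised_dihedral (gT : finGroupType) (A : {group gT}) (x : gT)
  : Prop :=
  [/\ abelian A, x \notin A, #[x] = 2,
      forall a, a \in A -> a ^ x = a^-1
    & A ><| <[x]> = [set: gT]].

(* The external direct product A x C_2, with C_2 the additive group Z/2. *)
Definition prod_C2 (gT : finGroupType) (A : {group gT}) : finGroupType :=
  (subg_of A * 'Z_2)%type.

(* Main.v *)
(* Write [C = {c in A | x c in S}].  The map [a |-> (a, 0)],
   [x b |-> (b^-1 k, 1)] carries [Cay(G, S)] to a Cayley digraph on [A x C_2]
   whose connection set is inverse-closed exactly when [C k^-1] is.  If [C] or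
   its complement in [A] is at most a singleton, such a [k] exists: the
   exceptional element if there is one.

   On an abelian group, if a guard at [u] has to move to [u s], then letting
   every guard move by [s] translates the whole set of guards, by an
   automorphism of the graph.  Hence the dominating sets of minimum size form
   an eternal dominating configuration. *)

Require Import Defs.
From HB Require Import structures.
From mathcomp Require Import all_boot all_fingroup zmodp.

Set Implicit Arguments.
Unset Strict Implicit.
Unset Printing Implicit Defensive.

Import GroupScope.

(** An isomorphism-invariant substitute for translations: it can be proved on the abelian side and
    carried back to the dihedral graph. *)
Definition edges_extend_to_shifts (T : finType) (e : rel T) : Prop :=
  forall u v, e u v -> exists t : T -> T,
    [/\ injective t, t u = v, forall d, e d (t d)
      & forall a b, e (t a) (t b) = e a b].

Section EternalDomination.

Variables (T : finType) (e : rel T).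

(** The guard that answers an attack on an unoccupied [w] starts at a vertex dominating [w]. *)
Lemma eternal_dominating_set_dominating (D : {set T}) :
  eternal_dominating_set e D -> dominating_set e D.
Proof.
case/existsP=> C /andP[/and3P[_ _ /forall_inP hC] DC].
apply/forallP=> w; apply/exists_inP.
have [wD|wD] := boolP (w \in D); first by exists w; rewrite // /dominates eqxx.
have /forallP/(_ w)/implyP/(_ wD) := hC D DC.
case/exists_inP=> D' _ /andP[wD' /existsP[f /and3P[_ /eqP fD /forall_inP hf]]].
move: wD'; rewrite -fD => /imsetP[d dD ->]; exists d => //.
exact: hf.
Qed.

Lemma dominating_set_imset (t : T -> T) (D : {set T}) :
  injective t -> (forall a b, e (t a) (t b) = e a b) ->
  dominating_set e D -> dominating_set e (t @: D).
Proof.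
move=> injt et /forallP domD; apply/forallP=> w.
have [t' _ t'K] := injF_bij injt.
have /exists_inP[u uD] := domD (t' w).
rewrite -[w in X in _ -> X]t'K => uw.
apply/exists_inP; exists (t u); first exact: imset_f.
by rewrite /dominates et (inj_eq injt).
Qed.

Lemma dominating_set_eternal (D : {set T}) :
  edges_extend_to_shifts e -> dominating_set e D -> eternal_dominating_set e D.
Proof.
move=> he domD; apply/existsP.
(* All dominating sets of the size of [D]; a shift preserves both domination and size. *)
exists [set E : {set T} | dominating_set e E && (#|E| == #|D|)].
rewrite inE domD eqxx !andbT; apply/and3P; split.
- by apply/set0Pn; exists D; rewrite inE domD eqxx.
- apply/forall_inP=> E; rewrite inE => /andP[_ /eqP->].
  by apply/forall_inP=> E'; rewrite inE eq_sym => /andP[].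
apply/forall_inP=> E; rewrite inE => /andP[domE /eqP cE].
apply/forallP=> w; apply/implyP=> wE.
have /forallP/(_ w)/exists_inP[u uE /orP[/eqP wu|/he]] := domE.
  by rewrite wu uE in wE.
case=> t [injt tu et autt]; apply/exists_inP; exists (t @: E).
  by rewrite inE dominating_set_imset //= card_imset // cE.
rewrite -tu imset_f //=; apply/existsP; exists (finfun t); apply/and3P; split.
- by apply/dinjectiveP=> a b _ _; rewrite !ffunE; apply: injt.
- by apply/eqP/eq_imset=> a; rewrite ffunE.
- by apply/forall_inP=> d _; rewrite ffunE et orbT.
Qed.

(** Dominating and eternal dominating sets are then the same sets, so both minima agree. *)
Lemma eternal_domination_number_eq :
  edges_extend_to_shifts e ->
  eternal_domination_number e = domination_number e.
Proof.
move=> he; rewrite /eternal_domination_number /domination_number.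
case: arg_minnP => [|D etD minD]; first exact: eternal_dominating_setT.
case: arg_minnP => [|E domE minE]; first exact: dominating_setT.
apply/eqP; rewrite eqn_leq minD ?minE //.
- exact: eternal_dominating_set_dominating.
- exact: dominating_set_eternal.
Qed.

End EternalDomination.

Lemma edges_extend_to_shifts_iso (T1 T2 : finType) (e1 : rel T1) (e2 : rel T2) :
  graph_isomorphic e1 e2 ->
  edges_extend_to_shifts e2 -> edges_extend_to_shifts e1.
Proof.
case=> f [g fK gK] fe he u v; rewrite -fe => /he[t [injt tu et autt]].
exists (g \o t \o f); split=> [||d|a b] /=.
- exact: inj_comp (inj_comp (can_inj gK) injt) (can_inj fK).
- by rewrite tu fK.
- by rewrite -fe gK.
- by rewrite -fe !gK autt fe.
Qed.

Lemma cayleyE (gT : finGroupType) (S : {set gT}) (u v : gT) :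
  cayley S u v = (u^-1 * v \in S).
Proof.
apply/exists_inP/idP => [[s sS /eqP->]|uvS]; first by rewrite mulKg.
by exists (u^-1 * v); rewrite ?mulKVg.
Qed.

(** Right multiplication by an element of [S] moves every vertex along an edge; commutativity makes
    it preserve adjacency. *)
Lemma cayley_abelian_shifts (gT : finGroupType) (S : {set gT}) :
  abelian [set: gT] -> edges_extend_to_shifts (cayley S).
Proof.
move=> /centsP cGG u v; rewrite cayleyE => uvS.
exists (fun d => d * (u^-1 * v)); split=> [||d|a b].
- exact: mulIg.
- exact: mulKVg.
- by rewrite cayleyE mulKg.
- rewrite !cayleyE; congr (_ \in S).
  by rewrite !(cGG _ _ (u^-1 * v)) ?inE // invMg -mulgA mulKg.
Qed.

Lemma abelian_prod_C2 (gT : finGroupType) (A : {group gT}) :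
  abelian A -> abelian [set: prod_C2 A].
Proof.
move=> /centsP cAA; apply/centsP=> -[a i] _ [b j] _.
congr pair; first by apply: val_inj; apply: cAA; apply: subgP.
exact: Zp_addC.
Qed.

Section GeneralisedDihedral.

Variables (gT : finGroupType) (A : {group gT}) (x : gT).
Hypothesis hG : generalised_dihedral A x.

Lemma gen_dihedral_card : #|[set: gT]| = (2 * #|A|)%N.
Proof. by case: hG => _ _ ox _ /sdprod_card <-; rewrite mulnC -ox. Qed.

Lemma gen_dihedral_mulx (a : gT) : a \in A -> a * x = x * a^-1.
Proof. by case: hG => _ _ _ ix _ aA; rewrite -ix // conjgE mulKVg. Qed.

Lemma gen_dihedral_coset (u : gT) : u \notin A -> x * u \in A.
Proof.
case: hG => _ _ ox _ /sdprodP[_ defG nAx _] uA.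
have xx : x * x = 1 by rewrite -expg2 -ox expg_order.
have: u \in <[x]> * A by rewrite (normC nAx) defG inE.
case/mulsgP=> y a /cycleP[i ->] aA ua.
have: x ^+ i = 1 \/ x ^+ i = x.
  rewrite (divn_eq i 2) expgD mulnC expgM expg2 xx expg1n mul1g modn2.
  by case: odd; [right | left].
by case=> yE; rewrite ua yE ?mul1g ?mulgA ?xx ?mul1g // in uA *; rewrite aA in uA.
Qed.

(** With [C] the set of [c] in [A] such that [x * c] is in [S], the condition on [k] says that
    [C k^-1] is inverse-closed. *)
Lemma cayley_gen_dihedral_iso (S : {set gT}) (k : gT) :
  inverse_closed S -> k \in A ->
  (forall a, a \in A -> x * a * k \in S -> x * a^-1 * k \in S) ->
  exists2 U : {set prod_C2 A},
    inverse_closed U & graph_isomorphic (cayley S) (cayley U).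
Proof.
move=> hS kA hk; have [cAA xA ox ix _] := hG.
have {}cAA a b : a \in A -> b \in A -> a * b = b * a.
  by move=> aA bA; apply: (centsP cAA).
have xx : x * x = 1 by rewrite -expg2 -ox expg_order.
have xV : x^-1 = x by apply/eqP; rewrite eq_invg_mul xx.
have hkE a : a \in A -> (x * a^-1 * k \in S) = (x * a * k \in S).
  move=> aA; apply/idP/idP; last exact: hk.
  by move/hk; rewrite invgK groupV; apply.
(* Layer 0 of [U] is the part of [S] in [A], layer 1 is [C k^-1]. Since [x] is an involution,
   [x * u] is the [b] with [u = x * b]. *)
pose U : {set prod_C2 A} := [set p |
  if p.2 == ord0 then sgval p.1 \in S else x * sgval p.1 * k \in S].
pose f u : prod_C2 A := if u \in A then (subg A u, ord0)
  else (subg A ((x * u)^-1 * k), Zp1).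
(* Inversion fixes the ['Z_2] component, so each layer is checked separately. *)
have Uinv : inverse_closed U.
  move=> [a i]; rewrite !inE /=.
  have ->: (i^-1 == ord0) = (i == ord0) by case: i => [[|[|]]].
  by case: (i == ord0) => [/hS //|]; apply: hk; apply: subgP.
exists U => //; exists f.
  apply: inj_card_bij; last first.
    rewrite card_prod card_sub card_ord mulnC -cardsT gen_dihedral_card.
    by rewrite leq_mul2l /=; apply/subset_leq_card/subsetP.
  move=> u v; rewrite /f; case: ifPn => uA; case: ifPn => vA //= [].
    by move=> /(congr1 val) /=; rewrite !subgK.
  move=> /(congr1 val) /=; rewrite !subgK.
  - by move/mulIg/invg_inj/mulgI.
  - by rewrite groupM ?groupV // gen_dihedral_coset.
  - by rewrite groupM ?groupV // gen_dihedral_coset.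
have SV a : (a^-1 \in S) = (a \in S).
  by apply/idP/idP=> /hS //; rewrite invgK.
have kVk z : z \in A -> k^-1 * z * k = z.
  by move=> zA; rewrite (cAA (k^-1 * z)) ?mulKVg ?groupM ?groupV.
move=> u v; rewrite !cayleyE inE /f.
have [uA|/gen_dihedral_coset] := boolP (u \in A);
  have [vA|/gen_dihedral_coset] := boolP (v \in A) => /=.
- by rewrite !subgK.
(* From [u] in [A] to [x * b]: the images differ by [u^-1 * b^-1 * k], and only its inverse gives
   back [x * u * b], hence [hkE]. *)
- move: (x * v) (mulKg x v) => b; rewrite xV => <- bA.
  rewrite !subgK ?groupM ?groupV // -hkE ?groupM ?groupV // [in RHS]mulgA.
  rewrite gen_dihedral_mulx ?groupV // !invMg !invgK -mulgA.
  by rewrite -(mulgA k^-1) kVk ?groupM // (cAA b u) // mulgA.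
- move: (x * u) (mulKg x u) => b; rewrite xV => <- bA.
  rewrite !subgK ?groupM ?groupV // !invMg !invgK xV.
  rewrite gen_dihedral_mulx ?groupV // invgK -mulgA.
  by rewrite -(mulgA k^-1) kVk ?groupM // mulgA.
(* Inside the coset [f] inverts differences, which [SV] absorbs. *)
- move: (x * v) (mulKg x v) => c; rewrite xV => <- cA.
  move: (x * u) (mulKg x u) => b; rewrite xV => <- bA.
  rewrite !subgK ?groupM ?groupV // !invMg !invgK xV.
  rewrite -[in LHS]SV !invMg !invgK -!mulgA (mulgA x x) xx mul1g.
  by rewrite (mulgA c) (mulgA k^-1) kVk ?groupM ?groupV // cAA ?groupV.
Qed.

Lemma gen_dihedral_symmetric_shift (S : {set gT}) (n : nat) :
  #|[set: gT]| = (2 * n)%N ->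
  (#|S :&: x *: A| <= 1)%N \/ (n - 1 <= #|S :&: x *: A|)%N ->
  exists2 k, k \in A &
    forall a, a \in A -> x * a * k \in S -> x * a^-1 * k \in S.
Proof.
rewrite gen_dihedral_card => /eqP; rewrite eqn_pmul2l // => /eqP <- {n} hSx.
(* [B] is the exceptional part of the coset: its intersection with [S] or the complement of that. *)
suff [B [leB1 BA hB]] : exists B : {set gT}, [/\ (#|B| <= 1)%N, B \subset x *: A &
    (forall y, y \in x *: A -> (y \in S) = (y \in B)) \/
    (forall y, y \in x *: A -> (y \in S) = (y \notin B))].
  have [k kA hk] : exists2 k, k \in A & B \subset [set x * k].
    (* Without an exceptional element any [k] works, and 1 is taken. *)
    have [B0|[y yB]] := set_0Vmem B; first by exists 1; rewrite ?group1 // B0 sub0set.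
    have /lcosetP[k kA yE] := subsetP BA y yB.
    exists k; rewrite // -yE; apply/subsetP=> z zB; rewrite inE; apply/eqP.
    by have /card_le1_eqP := leB1; apply.
  (* Membership in [B] depends on [a] only through [a == 1], a condition stable under inversion. *)
  have mB a : a \in A -> (x * a * k \in B) = (a == 1) && (x * k \in B).
    move=> aA; apply/idP/andP=> [aB|[/eqP-> ]]; last by rewrite mulg1.
    have := subsetP hk _ aB; rewrite inE -mulgA (inj_eq (mulgI x)).
    rewrite -{2}[k]mul1g (inj_eq (mulIg k)) => a1; split=> //.
    by move: aB; rewrite (eqP a1) mulg1.
  have inxA a : a \in A -> x * a * k \in x *: A.
    by move=> aA; rewrite -mulgA mem_lcoset mulKg groupM.
  exists k => // a aA.
  by case: hB => hB; rewrite !hB ?inxA ?groupV // !mB ?groupV // eq_invg1.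
case: hSx => h.
  exists (S :&: x *: A); split; rewrite ?subsetIr //.
  by left=> y yA; rewrite inE yA andbT.
exists (x *: A :\: S); split; rewrite ?subsetDl //; last first.
  by right=> y yA; rewrite inE yA andbT negbK.
(* The coset has [#|A|] elements, so at most one lies outside [S]. *)
have := cardsID S (x *: A); rewrite card_lcoset setIC => E.
by move: h; rewrite leq_subLR -E addnC leq_add2r.
Qed.

End GeneralisedDihedral.

Theorem corollary3p5 (gT : finGroupType) (A : {group gT}) (x : gT) (n : nat)
    (S : {set gT}) (hG : generalised_dihedral A x)
    (hn : #|[set: gT]| = (2 * n)%N) (hS : inverse_closed S)
    (hSx : (#|S :&: x *: A| <= 1)%N \/ (n - 1 <= #|S :&: x *: A|)%N) :
  (exists2 U : {set prod_C2 A},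
     inverse_closed U & graph_isomorphic (cayley S) (cayley U)) /\
  eternal_domination_number (cayley S) = domination_number (cayley S).
Proof.
have [k kA hk] := gen_dihedral_symmetric_shift hG hn hSx.
have [U Uinv isoU] := cayley_gen_dihedral_iso hG hS kA hk.
split; first by exists U.
apply: eternal_domination_number_eq; apply: edges_extend_to_shifts_iso isoU _.
by apply/cayley_abelian_shifts/abelian_prod_C2; case: hG.
Qed.
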